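(* Let $J\subset\mathbb{R}^n$ be a Jordan curve parametrised by $\gamma:[0,1]\to\mathbb{R}^n$, let $o=\gamma(0)$, let $\triangle$ be a triangle, and let $\theta_v$ denote the angle of $\triangle$ at a vertex $v$. If there is a vertex $v$ of $\triangle$ such that $$\limsup_{\delta\to0^+}\Theta_\delta<\theta_v<\liminf_{\delta\to0^+}\Theta'_\delta,$$ then there exist two points $p,q\in J\setminus\{o\}$ such that the triangle $\triangle opq$ with vertices $o,p,q$ is similar to $\triangle$, with the vertex $v$ corresponding to $o$.
   Context: A Jordan curve in $\mathbb{R}^n$ ($n\ge 2$) is the image $J=\gamma([0,1])$ of a continuous map $\gamma:[0,1]\to\mathbb{R}^n$ with $\gamma(0)=\gamma(1)$ that is injective except at the endpoints. Triangles are nondegenerate. The point $o=\gamma(0)$ is taken to be the origin of $\mathbb{R}^n$. Angles between nonzero vectors lie in $[0,\pi]$. For $\delta\in(0,\tfrac12)$, $\Theta_\delta:(0,\delta)\times(0,\delta)\to\mathbb{R}_{\ge0}$ maps $(s,s')$ to the angle between $\overrightarrow{o\gamma(s)}$ and $\overrightarrow{o\gamma(s')}$, and $\Theta'_\delta:(1-\delta,1)\times(0,\delta)\to\mathbb{R}_{\ge0}$ maps $(s,s')$ to the angle between $\overrightarrow{o\gamma(s)}$ and $\overrightarrow{o\gamma(s')}$. Convention: $\limsup_{\delta\to0^+}\Theta_\delta:=\lim_{\delta\to0^+}\sup\Theta_\delta$ and $\liminf_{\delta\to0^+}\Theta'_\delta:=\lim_{\delta\to0^+}\inf\Theta'_\delta$,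 where sup and inf are over the domains of the functions. *)

(* Defs.v *)
From HB Require Import structures.
From mathcomp Require Import all_boot all_order all_algebra all_fingroup.
From mathcomp Require Import all_classical all_reals all_analysis.
Import Order.TTheory GRing.Theory Num.Theory.
Import numFieldNormedType.Exports.

Set Implicit Arguments.
Unset Strict Implicit.
Unset Printing Implicit Defensive.

Local Open Scope classical_set_scope.
Local Open Scope ring_scope.

(* The library norm on 'rV[R]_n is the sup norm (it induces the usual topology
   of R^n); lengths and angles need the Euclidean structure below. *)
Definition dotv (R : realType) (n : nat) (u w : 'rV[R]_n) : R :=
  \sum_(i < n) u 0 i * w 0 i.

Definition enorm (R : realType) (n : nat) (u : 'rV[R]_n) : R :=
  Num.sqrt (dotv u u).

Definition edist (R : realType) (n : nat) (x y : 'rV[R]_n) : R :=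
  enorm (x - y).

(* In [0, pi]; only meaningful for nonzero vectors. *)
Definition angle (R : realType) (n : nat) (u w : 'rV[R]_n) : R :=
  acos (dotv u w / (enorm u * enorm w)).

Definition jordan_param (R : realType) (n : nat) (gamma : R -> 'rV[R]_n)
    (J : set 'rV[R]_n) : Prop :=
  [/\ {within `[0, 1], continuous gamma},
      gamma 0 = gamma 1,
      forall s t : R, s \in `[0, 1] -> t \in `[0, 1] -> gamma s = gamma t ->
        [\/ s = t, s = 0 /\ t = 1 | s = 1 /\ t = 0]
    & J = gamma @` `[0, 1]].

(* The common formula of Theta_delta and Theta'_delta; they differ only in
   their domains. *)
Definition Theta (R : realType) (n : nat) (gamma : R -> 'rV[R]_n)
    (x : R * R) : R :=
  angle (gamma x.1 - gamma 0) (gamma x.2 - gamma 0).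

Definition dom_Theta (R : realType) (delta : R) : set (R * R) :=
  `]0, delta[ `*` `]0, delta[.

Definition dom_Theta' (R : realType) (delta : R) : set (R * R) :=
  `](1 - delta), 1[ `*` `]0, delta[.

(* For a Jordan curve and 0 < delta < 1/2 the sets below are nonempty and
   contained in [0, pi], so sup and inf are genuine, and the limits exist since
   sup and inf are monotone in delta. *)
Definition limsup_Theta (R : realType) (n : nat) (gamma : R -> 'rV[R]_n) : R :=
  lim (sup (Theta gamma @` dom_Theta delta) @[delta --> (0 : R)^'+]).

Definition liminf_Theta' (R : realType) (n : nat) (gamma : R -> 'rV[R]_n) : R :=
  lim (inf (Theta gamma @` dom_Theta' delta) @[delta --> (0 : R)^'+]).

Definition collinear (R : realType) (m : nat) (T : 'I_3 -> 'rV[R]_m) : Prop :=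
  exists a u : 'rV[R]_m, forall i, exists t : R, T i = a + t *: u.

Definition triangle (R : realType) (m : nat) (T : 'I_3 -> 'rV[R]_m) : Prop :=
  ~ collinear T.

(* Indices are added modulo 3: the other two vertices are v + 1 and v + 2. *)
Definition vertex_angle (R : realType) (m : nat) (T : 'I_3 -> 'rV[R]_m)
    (v : 'I_3) : R :=
  angle (T (v + 1) - T v) (T (v + 2%:R) - T v).

Definition points3 (R : realType) (n : nat) (a b c : 'rV[R]_n)
    (i : 'I_3) : 'rV[R]_n :=
  nth a [:: a; b; c] i.

(* Similarity with the vertex S i corresponding to T (sigma i): corresponding
   sides are proportional. *)
Definition similar_via (R : realType) (n m : nat) (sigma : {perm 'I_3})
    (S : 'I_3 -> 'rV[R]_n) (T : 'I_3 -> 'rV[R]_m) : Prop :=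
  exists2 r : R, 0 < r &
    forall i j, edist (S i) (S j) = r * edist (T (sigma i)) (T (sigma j)).

(* Main.v *)
(** Fix [0 < mu <= 1] and let [|gamma|] be maximal at [m]. In the rectangle
    [[0, m] x [0, 1]], the zero set of [g (s, t) = |gamma s| - mu |gamma t|]
    separates the left side from the right side and touches the bottom and top sides
    only at [(0, 0)] and [(0, 1)]. Near the first corner the angle between [gamma s]
    and [gamma t] is smaller than the prescribed one, near the second corner it is
    larger; a Sperner-type argument therefore finds a zero of [g] at which
    the angle is exactly the prescribed one. Taking for [mu] the ratio of the sides
    at the vertex (shorter over longer) gives similarity by side-angle-side. *)
Require Import Defs.
From HB Require Import structures.
From mathcomp Require Import all_boot all_order all_algebra all_fingroup.
From mathcomp Require Import all_classical all_reals all_analysis.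
From mathcomp Require Import ring lra zify.
Import Order.TTheory GRing.Theory Num.Theory.
Import numFieldNormedType.Exports.
Local Open Scope classical_set_scope.
Local Open Scope ring_scope.

(** * Sperner-type lemmas on a grid and on a rectangle *)

(** Each grid point carries exactly one of the labels [P], [~~ P && L], [~~ P && ~~ L]. The boundary
    conditions make the labels wind once around the boundary, which is impossible if every unit
    square misses a label. *)
Lemma grid_square_three_labels (N : nat) (P L : nat -> nat -> bool) :
  (forall j, (j <= N)%N -> ~~ P 0%N j) ->
  (forall j, (j <= N)%N -> P N j) ->
  (forall i, (i <= N)%N -> P i 0%N || L i 0%N) ->
  (forall i, (i <= N)%N -> P i N || ~~ L i N) ->
  exists i j, [/\ (i < N)%N, (j < N)%N &
    let meets (Q : nat -> nat -> bool) :=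
      [|| Q i j, Q i.+1 j, Q i j.+1 | Q i.+1 j.+1] in
    [/\ meets P, meets (fun k l => ~~ P k l && L k l)
      & meets (fun k l => ~~ P k l && ~~ L k l)]].
Proof.
move=> Pl Pr Lb Lt; apply: contrapT => noq.
(* A discrete 1-form, exact wherever one of the three labels is missing: telescoping it
   around the boundary of the grid would give both 0 and -1. *)
pose w i j k l : int :=
  if P i j || P k l then 0 else (L i j)%:Z - (L k l)%:Z.
have closed i j : (i < N)%N -> (j < N)%N ->
    w i j i.+1 j + w i.+1 j i.+1 j.+1 = w i j i j.+1 + w i j.+1 i.+1 j.+1.
  move=> iN jN; apply: contrapT => wN; apply: noq; exists i, j; split => //.
  move: wN; rewrite /w /=.
  case: (P i j); case: (P i.+1 j); case: (P i j.+1); case: (P i.+1 j.+1);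
  case: (L i j); case: (L i.+1 j); case: (L i j.+1); case: (L i.+1 j.+1);
  by move=> // [].
(* [S j] integrates the form along row [j]. Moving up one row changes it only by the increment of
   [L] on the left edge, as the form vanishes on the right edge, where [P] holds. The left corners
   then give [S N = -1], the top row [S N = 0]. *)
pose S j : int := \sum_(0 <= i < N) w i j i.+1 j.
have S_rec j : (j < N)%N -> S j.+1 = S j - (L 0%N j)%:Z + (L 0%N j.+1)%:Z.
  move=> jN.
  have -> : S j.+1 = S j + \sum_(0 <= i < N) (w i.+1 j i.+1 j.+1 - w i j i j.+1).
    rewrite -big_split /= /S; apply: eq_big_nat => i /andP[_ iN].
    by have := closed i j iN jN; lia.
  rewrite (telescope_sumr (fun i => w i j i j.+1)) //.
  rewrite /w (negbTE (Pl j _)) ?(negbTE (Pl j.+1 _)) ?Pr //=; lia.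
have SE j : (j <= N)%N -> S j = (L 0%N j)%:Z - (L 0%N 0%N)%:Z.
  elim: j => [_|j IH jN]; last by rewrite S_rec // IH ?(ltnW jN) //; lia.
  rewrite subrr /S; rewrite big_nat big1 // => i /andP[_ iN]; rewrite /w.
  have := Lb i (ltnW iN); have := Lb i.+1 iN.
  by case: (P i 0%N); case: (P i.+1 0%N) => //= -> ->.
have SN0 : S N = 0.
  rewrite /S big_nat big1 // => i /andP[_ iN]; rewrite /w.
  have := Lt i (ltnW iN); have := Lt i.+1 iN.
  by case: (P i N); case: (P i.+1 N) => //= /negbTE -> /negbTE ->.
have := SE N (leqnn N); rewrite SN0.
have := Lb 0%N (leq0n N); have := Lt 0%N (leq0n N).
by rewrite (negbTE (Pl _ (leq0n N))) (negbTE (Pl _ (leqnn N))) /= => /negbTE -> ->.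
Qed.

(** Ever finer grids give squares showing all three labels; by compactness the corners of these
    squares have a cluster point, which every label approaches. Closures are unavoidable since the
    labels exclude each other. *)
Lemma rectangle_three_closures (R : realType) (a b : R) (P L : R -> R -> bool) :
  0 < a -> 0 < b ->
  (forall t, 0 <= t <= b -> ~~ P 0 t) ->
  (forall t, 0 <= t <= b -> P a t) ->
  (forall s, 0 <= s <= a -> P s 0 || L s 0) ->
  (forall s, 0 <= s <= a -> P s b || ~~ L s b) ->
  exists x : R * R, [/\ 0 <= x.1 <= a, 0 <= x.2 <= b &
    let meets (Q : R -> R -> bool) :=
      closure [set z | [/\ 0 <= z.1 <= a, 0 <= z.2 <= b & Q z.1 z.2]] x in
    [/\ meets P, meets (fun s t => ~~ P s t && L s t)
      & meets (fun s t => ~~ P s t && ~~ L s t)]].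
Proof.
move=> a0 b0 Pl Pr Lb Lt.
pose D : set (R * R) := [set z | 0 <= z.1 <= a /\ 0 <= z.2 <= b].
have near_labels (N : nat) : exists x : R * R, D x /\
    let meets (Q : R -> R -> bool) := exists z, [/\ D z, Q z.1 z.2,
      `|x.1 - z.1| <= a / N.+1%:R & `|x.2 - z.2| <= b / N.+1%:R] in
    [/\ meets P, meets (fun s t => ~~ P s t && L s t)
      & meets (fun s t => ~~ P s t && ~~ L s t)].
  pose g c i : R := c * (i%:R / N.+1%:R).
  have n0 : (0 : R) < N.+1%:R by rewrite ltr0n.
  have g0 c : g c 0%N = 0 by rewrite /g mul0r mulr0.
  have gN c : g c N.+1 = c by rewrite /g divff ?mulr1 ?gt_eqF.
  have gD c i : 0 < c -> (i <= N.+1)%N -> 0 <= g c i <= c.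
    move=> c0 iN; rewrite /g mulr_ge0 ?(ltW c0) ?divr_ge0 ?ler0n //=.
    by rewrite ger_pMr // ler_pdivrMr // mul1r ler_nat.
  have gS c i : 0 < c -> `|g c i - g c i.+1| = c / N.+1%:R.
    move=> c0; rewrite /g -mulrBr -mulrBl -natr1 opprD addNKr mulN1r mulrN normrN.
    by rewrite ger0_norm // mulr_ge0 ?(ltW c0) // invr_ge0 ltW.
  have [] := @grid_square_three_labels N.+1 (fun i j => P (g a i) (g b j))
    (fun i j => L (g a i) (g b j)).
  - by move=> j jN; rewrite g0; apply/Pl/gD.
  - by move=> j jN; rewrite gN; apply/Pr/gD.
  - by move=> i iN; rewrite g0; apply/Lb/gD.
  - by move=> i iN; rewrite gN; apply/Lt/gD.
  move=> i [j [iN jN sq]]; exists (g a i, g b j); split.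
    by split; apply: gD; rewrite // ltnW.
  have meetsP (Q : R -> R -> bool) :
      [|| Q (g a i) (g b j), Q (g a i.+1) (g b j), Q (g a i) (g b j.+1)
        | Q (g a i.+1) (g b j.+1)] ->
      exists z : R * R, [/\ D z, Q z.1 z.2, `|g a i - z.1| <= a / N.+1%:R
        & `|g b j - z.2| <= b / N.+1%:R].
    have i1 := gD a _ a0 iN; have j1 := gD b _ b0 jN.
    have i0 := gD a _ a0 (ltnW iN); have j0 := gD b _ b0 (ltnW jN).
    have aN0 : 0 <= a / N.+1%:R by rewrite divr_ge0 // ltW.
    have bN0 : 0 <= b / N.+1%:R by rewrite divr_ge0 // ltW.
    case/or4P => Qz; [exists (g a i, g b j) | exists (g a i.+1, g b j)
      | exists (g a i, g b j.+1) | exists (g a i.+1, g b j.+1)];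
      by split => //=; rewrite ?subrr ?normr0 ?gS.
  case: sq => sP sL sU; split; [exact: meetsP sP| |].
    exact: (meetsP (fun s t => ~~ P s t && L s t) sL).
  exact: (meetsP (fun s t => ~~ P s t && ~~ L s t) sU).
have [x /all_and2[xD xP]] := choice near_labels.
have Dc : compact D.
  have -> : D = `[0, a]%classic `*` `[0, b]%classic.
    by rewrite eqEsubset; split => z /=; rewrite !in_itv.
  by apply: compact_setX; exact: segment_compact.
have [|y [Dy xy]] := Dc (x @ \oo) _.
  by exists 0%N => // N _; exact: xD.
have meetsP (Q : R -> R -> bool) :
    (forall N, exists z, [/\ D z, Q z.1 z.2, `|(x N).1 - z.1| <= a / N.+1%:R
      & `|(x N).2 - z.2| <= b / N.+1%:R]) ->
    closure [set z | [/\ 0 <= z.1 <= a, 0 <= z.2 <= b & Q z.1 z.2]] y.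
  move=> QN B /nbhs_ballP[e /= e0 eB].
  have e2 : 0 < e / 2 by rewrite divr_gt0.
  have tail : (x @ \oo) (x @` [set N | a / N.+1%:R < e / 2 /\ b / N.+1%:R < e / 2]).
    have small c : 0 < c -> \forall N \near \oo, c / N.+1%:R < e / 2.
      move=> c0; have c1 : 0 < e / 2 / c by rewrite divr_gt0.
      have := near_infty_natSinv_lt (PosNum c1); apply: filterS => N /= cN.
      by rewrite mulrC -ltr_pdivlMr.
    by apply: filterS2 (small a a0) (small b b0) => N Na Nb; exists N.
  have [_ [[N [Na Nb] <-] [/= y1 y2]]] := xy _ (ball y (e / 2)) tail (nbhsx_ballx y _ e2).
  have [z [[Dz1 Dz2] Qz z1 z2]] := QN N; exists z; split => //; apply: eB.
  rewrite (splitr e); split; [apply: ball_triangle y1 _|apply: ball_triangle y2 _].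
  - exact: le_lt_trans z1 Na.
  - exact: le_lt_trans z2 Nb.
exists y; case: Dy => y1 y2; split => //=; split.
- by apply: meetsP => N; case: (xP N).
- by apply: (meetsP (fun s t => ~~ P s t && L s t)) => N; case: (xP N).
- by apply: (meetsP (fun s t => ~~ P s t && ~~ L s t)) => N; case: (xP N).
Qed.

(** * Euclidean scalar product, norm and angle *)

Section Dot.
Context {R : realType} {n : nat}.
Implicit Types u w : 'rV[R]_n.

Lemma dotvC u w : dotv u w = dotv w u.
Proof. by apply: eq_bigr => i _; rewrite mulrC. Qed.

Lemma dotv_ge0 u : 0 <= dotv u u.
Proof. by apply: sumr_ge0 => i _; rewrite -expr2 sqr_ge0. Qed.

Lemma dotv_eq0 u : (dotv u u == 0) = (u == 0).
Proof.
apply/idP/eqP => [|->]; last first.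
  by rewrite /dotv big1 // => i _; rewrite mxE mul0r.
rewrite psumr_eq0 => [/allP u0|i _]; last by rewrite -expr2 sqr_ge0.
apply/rowP => i; rewrite mxE; apply/eqP.
by have := u0 i (mem_index_enum i); rewrite /= mulf_eq0 orbb.
Qed.

Lemma dotv_comb (x y : R) u w :
  dotv (x *: u + y *: w) (x *: u + y *: w) =
  x ^+ 2 * dotv u u + 2 * x * y * dotv u w + y ^+ 2 * dotv w w.
Proof.
rewrite /dotv !mulr_sumr -!big_split /=; apply: eq_bigr => i _.
by rewrite !mxE; ring.
Qed.

Lemma dotv_sub u w : dotv (u - w) (u - w) = dotv u u - 2 * dotv u w + dotv w w.
Proof. by have := dotv_comb 1 (-1) u w; rewrite scale1r scaleN1r => ->; ring. Qed.

Lemma sqr_enorm u : enorm u ^+ 2 = dotv u u.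
Proof. exact/sqr_sqrtr/dotv_ge0. Qed.

Lemma enorm_ge0 u : 0 <= enorm u.
Proof. exact: sqrtr_ge0. Qed.

Lemma enorm_eq0 u : (enorm u == 0) = (u == 0).
Proof. by rewrite -dotv_eq0 -sqr_enorm sqrf_eq0. Qed.

Lemma enorm_gt0 u : (0 < enorm u) = (u != 0).
Proof. by rewrite lt_def enorm_ge0 andbT enorm_eq0. Qed.

Lemma cauchy_schwarz u w : dotv u w ^+ 2 <= dotv u u * dotv w w.
Proof.
have [->|w0] := eqVneq w 0.
  have -> : dotv u 0 = 0 by rewrite /dotv big1 // => i _; rewrite mxE mulr0.
  by rewrite expr0n mulr_ge0 ?dotv_ge0.
have ww : 0 < dotv w w by rewrite lt_def dotv_ge0 dotv_eq0 w0.
(* This vector is [dotv w w] times the component of [u] orthogonal to [w]. *)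
have := dotv_ge0 (dotv w w *: u + (- dotv u w) *: w).
rewrite dotv_comb.
have -> : dotv w w ^+ 2 * dotv u u + 2 * dotv w w * - dotv u w * dotv u w +
  (- dotv u w) ^+ 2 * dotv w w =
  dotv w w * (dotv u u * dotv w w - dotv u w ^+ 2) by ring.
by rewrite pmulr_rge0 // subr_ge0.
Qed.

Lemma cos_bound u w : -1 <= dotv u w / (enorm u * enorm w) <= 1.
Proof.
have p0 : 0 <= enorm u * enorm w by rewrite mulr_ge0 ?enorm_ge0.
rewrite -ler_norml normrM normfV (ger0_norm p0).
have [->|pn] := eqVneq (enorm u * enorm w) 0; first by rewrite invr0 mulr0.
rewrite ler_pdivrMr ?lt_def ?pn // mul1r.
by rewrite -(ler_pXn2r (n := 2)) ?nnegrE // exprMn !sqr_enorm real_normK ?num_real ?cauchy_schwarz.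
Qed.

Lemma angle_itv u w : angle u w \in `[0, pi].
Proof. by rewrite in_itv /= acos_ge0 ?acos_lepi ?cos_bound. Qed.

Lemma angleC u w : angle u w = angle w u.
Proof. by rewrite /angle dotvC [enorm u * _]mulrC. Qed.

Lemma dotv_angle u w : dotv u w = cos (angle u w) * (enorm u * enorm w).
Proof.
rewrite /angle acosK ?in_itv /= ?cos_bound //.
have [p0|pn] := eqVneq (enorm u * enorm w) 0; last by rewrite divfK.
(* If a norm is zero the angle is a default value, but both sides vanish, the left one by
   Cauchy-Schwarz. *)
rewrite p0 mulr0; apply/eqP; rewrite -sqrf_eq0 eq_le sqr_ge0 andbT.
by rewrite (le_trans (cauchy_schwarz _ _)) // -!sqr_enorm -exprMn p0 expr0n.
Qed.

(** Cosine decreases on [[0, pi]]. This trades the angle, meaningless at zero vectors, for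
    expressions continuous everywhere. *)
Lemma angle_lt u w (theta : R) : u != 0 -> w != 0 -> theta \in `[0, pi] ->
  (angle u w < theta) = (cos theta * (enorm u * enorm w) < dotv u w).
Proof.
move=> u0 w0 th; rewrite dotv_angle ltr_pM2r ?mulr_gt0 ?enorm_gt0 //.
by rewrite ltr_cos ?angle_itv.
Qed.

Lemma angle_gt u w (theta : R) : u != 0 -> w != 0 -> theta \in `[0, pi] ->
  (theta < angle u w) = (dotv u w < cos theta * (enorm u * enorm w)).
Proof.
move=> u0 w0 th; rewrite [in RHS]dotv_angle ltr_pM2r ?mulr_gt0 ?enorm_gt0 //.
by rewrite ltr_cos ?angle_itv.
Qed.

Lemma edistC u w : Defs.edist u w = Defs.edist w u.
Proof.
rewrite /Defs.edist /enorm -opprB; congr Num.sqrt.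
by apply: eq_bigr => i _; rewrite !mxE mulrNN.
Qed.

Lemma edistxx u : Defs.edist u u = 0.
Proof. by apply/eqP; rewrite /Defs.edist subrr enorm_eq0. Qed.

Lemma sqr_edist u w : Defs.edist u w ^+ 2 = dotv u u - 2 * dotv u w + dotv w w.
Proof. by rewrite /Defs.edist sqr_enorm dotv_sub. Qed.

Lemma continuous_dotv (T : topologicalType) (f g : T -> 'rV[R]_n) :
  continuous f -> continuous g -> continuous (fun x => dotv (f x) (g x)).
Proof.
move=> fc gc x; rewrite /dotv; apply: cvg_big => [z|i _].
  by apply: cvgD; [exact: cvg_fst|exact: cvg_snd].
have coord (h : T -> 'rV[R]_n) : continuous h -> h y 0 i @[y --> x] --> h x 0 i.
  by move=> hc; exact: (cvg_comp _ _ (hc x) (@coord_continuous _ _ _ 0 i (h x))).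
by apply: cvgM; exact: coord.
Qed.

Lemma continuous_enorm (T : topologicalType) (f : T -> 'rV[R]_n) :
  continuous f -> continuous (fun x => enorm (f x)).
Proof.
move=> fc x.
exact: (cvg_comp _ _ (@continuous_dotv _ _ _ fc fc x) (@sqrt_continuous R _)).
Qed.

End Dot.

(** * Limits of suprema and infima over shrinking domains *)

Section LimSupInf.
Context {R : realType} {X : Type} (F : X -> R) (D : R -> set X) (lo hi : R).
Context (F_bound : forall x, lo <= F x <= hi).
Context (D_nonempty : forall d, 0 < d -> D d !=set0).
Context (D_mono : forall d e, d <= e -> D d `<=` D e).

Let FD d := F @` D d.

Let FD_ub d : has_ubound (FD d).
Proof. by exists hi => _ [x _ <-]; have /andP[] := F_bound x. Qed.

Let FD_lb d : has_lbound (FD d).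
Proof. by exists lo => _ [x _ <-]; have /andP[] := F_bound x. Qed.

Let FD_nonempty d : 0 < d -> FD d !=set0.
Proof. by move=> /D_nonempty[x Dx]; exists (F x), x. Qed.

Let FD_mono d e : d <= e -> FD d `<=` FD e.
Proof. by move=> de _ [x Dx <-]; exists x => //; exact: D_mono Dx. Qed.

(** The supremum is monotone in [d] and bounded below by [lo], so [lim] is a genuine limit and not a
    default value; if it is below [l], so is some supremum. *)
Lemma lim_sup_lt l : lim (sup (FD d) @[d --> 0^'+]) < l ->
  exists2 d, 0 < d & forall x, D d x -> F x < l.
Proof.
have cv : cvg (sup (FD d) @[d --> 0^'+]).
  apply: nondecreasing_at_right_is_cvgr; near=> e.
    move=> d d'; rewrite in_itv /= => /andP[d0 _] _ dd'; apply: sup_le.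
    - by move=> y Fy; exists y; split => //; exact: FD_mono Fy.
    - exact: FD_nonempty.
    - by split; [apply: FD_nonempty; exact: lt_le_trans d0 dd'|exact: FD_ub].
  exists lo => z [d /=]; rewrite in_itv /= => /andP[d0 _] <-.
  have [y Fy] := FD_nonempty d d0; apply: (le_trans _ (ub_le_sup (FD_ub d) Fy)).
  by have [x _ <-] := Fy; have /andP[] := F_bound x.
move=> /(cvgr_lt _ cv) supl.
have [d [d0 dl]] := @filter_ex _ _ _ _ (filterI (nbhs_right_gt 0) supl).
by exists d => // x Dx; apply: (le_lt_trans _ dl); apply: ub_le_sup => //; exists x.
Unshelve. all: by end_near.
Qed.

Lemma lim_inf_gt l : l < lim (inf (FD d) @[d --> 0^'+]) ->
  exists2 d, 0 < d & forall x, D d x -> l < F x.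
Proof.
have cv : cvg (inf (FD d) @[d --> 0^'+]).
  apply: nonincreasing_at_right_is_cvgr; near=> e.
    move=> d d'; rewrite in_itv /= => /andP[d0 _] _ dd'.
    apply: lb_le_inf; first exact: FD_nonempty.
    by move=> y Fy; apply: ge_inf => //; exact: FD_mono Fy.
  exists hi => z [d /=]; rewrite in_itv /= => /andP[d0 _] <-.
  have [y Fy] := FD_nonempty d d0; apply: le_trans (ge_inf (FD_lb d) Fy) _.
  by have [x _ <-] := Fy; have /andP[] := F_bound x.
move=> /(cvgr_gt _ cv) infl.
have [d [d0 dl]] := @filter_ex _ _ _ _ (filterI (nbhs_right_gt 0) infl).
by exists d => // x Dx; apply: (lt_le_trans dl); apply: ge_inf => //; exists x.
Unshelve. all: by end_near.
Qed.

End LimSupInf.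

Lemma limsup_Theta_lt (R : realType) (n : nat) (gamma : R -> 'rV[R]_n) (theta : R) :
  limsup_Theta gamma < theta ->
  exists2 d, 0 < d & forall s t, 0 < s < d -> 0 < t < d ->
    angle (gamma s - gamma 0) (gamma t - gamma 0) < theta.
Proof.
case/(@lim_sup_lt _ _ _ _ 0 pi) => [x|d d0|d e de [s t]|d d0 dl].
- by have := angle_itv (gamma x.1 - gamma 0) (gamma x.2 - gamma 0); rewrite in_itv.
- by exists (d / 2, d / 2); split; rewrite /= in_itv /=; lra.
- by case; rewrite /= !in_itv /= => sd td; split; rewrite /= in_itv /=; lra.
- by exists d => // s t sd td; apply: (dl (s, t)); split; rewrite /= in_itv.
Qed.

Lemma lt_liminf_Theta' (R : realType) (n : nat) (gamma : R -> 'rV[R]_n) (theta : R) :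
  theta < liminf_Theta' gamma ->
  exists2 d, 0 < d & forall s t, 1 - d < s < 1 -> 0 < t < d ->
    theta < angle (gamma s - gamma 0) (gamma t - gamma 0).
Proof.
case/(@lim_inf_gt _ _ _ _ 0 pi) => [x|d d0|d e de [s t]|d d0 dl].
- by have := angle_itv (gamma x.1 - gamma 0) (gamma x.2 - gamma 0); rewrite in_itv.
- by exists (1 - d / 2, d / 2); split; rewrite /= in_itv /=; lra.
- by case; rewrite /= !in_itv /= => sd td; split; rewrite /= in_itv /=; lra.
- by exists d => // s t sd td; apply: (dl (s, t)); split; rewrite /= in_itv.
Qed.

(** * Pairs on a loop with prescribed norm ratio and angle *)

(** A local form of the closedness of [0 <= f]: the sign is assumed only on the neighbourhood [B],
    because labels will match the sign of a function only away from some edges. *)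
Lemma closure_nbhs_ge0 {R : realType} {T : topologicalType} {A B : set T}
    {f : T -> R} {x : T} : continuous f -> nbhs x B ->
  (forall z, A z -> B z -> 0 <= f z) -> closure A x -> 0 <= f x.
Proof.
move=> fc xB f0 xA.
have fcl : closed [set z | 0 <= f z].
  by have /continuous_closedP := fc; move=> /(_ _ (@closed_ge R 0)).
apply: fcl => C xC; have [z [Az [Bz Cz]]] := xA _ (filterI xB xC).
by exists z; split => //; exact: f0.
Qed.

(** Here [kappa] plays the cosine of the prescribed angle and [c] a continuous extension of [gamma]
    to the line. A zero of [g] gives the norm ratio, a zero of [k] the angle; a point in the
    closures of all three label sets yields both. *)
Lemma proportional_pair (R : realType) (n : nat) (c : R -> 'rV[R]_n)
    (kappa mu d : R) :
  continuous c -> c 0 = 0 -> c 1 = 0 ->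
  (forall t, 0 < t < 1 -> c t != 0) ->
  0 < mu <= 1 -> 0 < d ->
  (forall s t, 0 < s < d -> 0 < t < d ->
    kappa * (enorm (c s) * enorm (c t)) < dotv (c s) (c t)) ->
  (forall s t, 0 < s < d -> 1 - d < t < 1 ->
    dotv (c s) (c t) < kappa * (enorm (c s) * enorm (c t))) ->
  exists s t, [/\ 0 < s < 1, 0 < t < 1, enorm (c s) = mu * enorm (c t)
    & dotv (c s) (c t) = kappa * (enorm (c s) * enorm (c t))].
Proof.
move=> cc c0 c1 cn0 /andP[mu0 mu1] d0 near0 near1.
pose rho t := enorm (c t).
pose k (z : R * R) := dotv (c z.1) (c z.2) - kappa * (rho z.1 * rho z.2).
pose g (z : R * R) := rho z.1 - mu * rho z.2.
have c1c : continuous (fun z : R * R => c z.1).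
  by move=> z; apply: (@continuous_comp _ _ _ fst c); [exact: cvg_fst|exact: cc].
have c2c : continuous (fun z : R * R => c z.2).
  by move=> z; apply: (@continuous_comp _ _ _ snd c); [exact: cvg_snd|exact: cc].
have rhoc := continuous_enorm _ _ cc.
have r1c := continuous_enorm _ _ c1c; have r2c := continuous_enorm _ _ c2c.
have kc : continuous k.
  move=> z; apply: cvgB; first exact: continuous_dotv.
  by apply: cvgM; [exact: cvg_cst|apply: cvgM; [exact: r1c|exact: r2c]].
have gc : continuous g.
  move=> z; apply: cvgB; first exact: r1c.
  by apply: cvgM; [exact: cvg_cst|exact: r2c].
have oppc (f : R * R -> R) : continuous f -> continuous (fun z => - f z).
  by move=> fc z; apply: cvgN; exact: fc.
have rho0 : rho 0 = 0 by apply/eqP; rewrite enorm_eq0 c0.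
have rho1 : rho 1 = 0 by apply/eqP; rewrite enorm_eq0 c1.
clear c0 c1.
have rho_gt0 t : 0 < t < 1 -> 0 < rho t by rewrite enorm_gt0 => /cn0.
have rho_ge0 t : 0 <= rho t by exact: enorm_ge0.
(* Since [mu <= 1], maximality gives [0 <= g (m, t)] for all [t] in [[0, 1]]; the whole right side
   can thus be put into [P] while keeping [g] nonnegative on [P]. *)
have [m] := EVT_max (@ler01 R) (continuous_subspaceT rhoc).
rewrite in_itv /= => /andP[m0 m1] mmax.
have rhom : 0 < rho m.
  have h : 0 < (1 / 2 : R) < 1 by lra.
  have h01 : (1 / 2 : R) \in `[0, 1] by rewrite in_itv /=; case/andP: h => /ltW -> /ltW ->.
  exact: lt_le_trans (rho_gt0 _ h) (mmax _ h01).
have {}m0 : 0 < m by rewrite lt_def m0 andbT; apply: contraTneq rhom => ->; rewrite rho0 ltxx.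
have {}m1 : m < 1 by rewrite lt_def m1 andbT; apply: contraTneq rhom => <-; rewrite rho1 ltxx.
(* The region [P] is to the right of the zero set of [g]; the points to its left are
   split by the sign of [k], except on the edges, where [c] vanishes and the
   label is forced by the corner. *)
pose P s t := (s == m) || (0 < g (s, t)).
pose L s t := (t == 0) || (t != 1) && (if s == 0 then t <= 1 / 2 else 0 < k (s, t)).
have [||||x [x1 x2 [xP xL xU]]] := @rectangle_three_closures R m 1 P L m0 ltr01.
- move=> t t01; rewrite /P negb_or lt_eqF //= -leNgt /g /= rho0 sub0r oppr_le0.
  by rewrite mulr_ge0 // ltW.
- by move=> t _; rewrite /P eqxx.
- by move=> s _; rewrite /L eqxx orbT.
- by move=> s _; rewrite /L eqxx oner_eq0 orbT.
have gx : g x = 0.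
  apply/eqP; rewrite eq_le; apply/andP; split.
    rewrite -oppr_ge0.
    apply: (closure_nbhs_ge0 (oppc _ gc) filterT _ xL) => -[s t] [_ _ /andP[+ _]] _.
    by rewrite /P negb_or -leNgt oppr_ge0 => /andP[].
  apply: (closure_nbhs_ge0 gc filterT _ xP) => -[s t] [_ /= t01 +] _.
  move=> /orP[/eqP ->|/ltW //]; rewrite /g /= subr_ge0.
  by rewrite (le_trans _ (mmax t _)) ?in_itv //= ler_piMl.
have rhoE : rho x.1 = mu * rho x.2 by apply/eqP; rewrite -subr_eq0; apply/eqP.
have ballE (e : R) (z : R * R) : ball x e z -> `|x.1 - z.1| < e /\ `|x.2 - z.2| < e.
  by [].
have rho_eq0 t : 0 <= t <= 1 -> (rho t == 0) = (t == 0) || (t == 1).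
  move=> /andP[t0 t1]; have [->|tn0] := eqVneq t 0; first by rewrite rho0 eqxx.
  have [->|tn1] := eqVneq t 1; first by rewrite rho1 eqxx.
  by rewrite gt_eqF ?rho_gt0 // !lt_def tn0 t0 eq_sym tn1.
have x11 : x.1 < 1 by case/andP: x1 => _ /le_lt_trans; apply.
(* On the zero set of [g], [c] vanishes at both coordinates or at neither. So [x] is a left corner
   or has both coordinates strictly between 0 and 1. *)
have x10 : (x.1 == 0) = (x.2 == 0) || (x.2 == 1).
  have x1I : 0 <= x.1 <= 1 by case/andP: x1 => -> _; exact: ltW.
  have := rho_eq0 _ x1I; rewrite (lt_eqF x11) orbF => <-.
  by rewrite rhoE mulf_eq0 (gt_eqF mu0) rho_eq0.
have [x10'|x10'] := boolP (x.1 == 0).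
  exfalso.
  (* Within this radius of a left corner one label is absent: [d] fixes the sign of [k], and [1 / 2]
     is where the label changes along the left edge. At [(0, 0)] the label [~~ P && ~~ L] is
     missing, at [(0, 1)] the label [~~ P && L]. *)
  have e0 : 0 < Num.min d (1 / 2) by rewrite lt_min d0; lra.
  move: x10; rewrite x10' => /esym /orP[] /eqP x20.
  - have [[s t] [[/= sI tI /andP[_ stL]] /ballE]] := xU _ (nbhsx_ballx x _ e0).
    rewrite (eqP x10') x20 /= !sub0r !normrN !lt_min !ltr_norml => -[sd td].
    move: stL; rewrite /L; have [//|tn0 /=] := eqVneq t 0; rewrite lt_eqF /=; last by lra.
    have [_|sn0] := eqVneq s 0; first by move=> /negP; apply; lra.
    have s0 : 0 < s by rewrite lt_def sn0; case/andP: sI.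
    have t0 : 0 < t by rewrite lt_def tn0; case/andP: tI.
    by rewrite subr_gt0 near0 //=; lra.
  - have [[s t] [[/= sI tI /andP[_ stL]] /ballE]] := xL _ (nbhsx_ballx x _ e0).
    rewrite (eqP x10') x20 /= !sub0r !normrN !lt_min !ltr_norml => -[sd td].
    move: stL; rewrite /L gt_eqF /=; last by lra.
    have [//|tn1 /=] := eqVneq t 1.
    have [_|sn0] := eqVneq s 0; first by lra.
    have s0 : 0 < s by rewrite lt_def sn0; case/andP: sI.
    have t1 : t < 1 by rewrite lt_def eq_sym tn1; case/andP: tI.
    by rewrite subr_gt0 ltNge ltW // near1 //=; lra.
have x1I : 0 < x.1 < 1.
  by move: x1 => /andP[x1 x1m]; rewrite lt_def x10' x1 (le_lt_trans x1m).
have x2I : 0 < x.2 < 1.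
  move: x10' x2; rewrite x10 negb_or => /andP[n0 n1] /andP[x20 x21].
  by rewrite !lt_def n0 x20 eq_sym n1.
exists x.1, x.2; split => //.
(* This radius keeps the ball off the left, bottom and top edges, where [L] is set by convention
   rather than by the sign of [k]. *)
have e0 : 0 < Num.min x.1 (Num.min x.2 (1 - x.2)) by rewrite !lt_min; lra.
have Lk z : ball x (Num.min x.1 (Num.min x.2 (1 - x.2))) z -> L z.1 z.2 = (0 < k z).
  case: z => s t /ballE[]; rewrite !lt_min /= !ltr_norml => sx tx.
  have [s0 t0 t1] : [/\ 0 < s, 0 < t & t < 1] by split; lra.
  by rewrite /L (gt_eqF s0) (gt_eqF t0) (lt_eqF t1).
apply/eqP; rewrite -subr_eq0 -/(k x) eq_le; apply/andP; split.
  rewrite -oppr_ge0; apply: (closure_nbhs_ge0 (oppc _ kc) (nbhsx_ballx x _ e0) _ xU).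
  by move=> z [_ _ /andP[_ zL]] zx; move: zL; rewrite (Lk _ zx) -leNgt oppr_ge0.
apply: (closure_nbhs_ge0 kc (nbhsx_ballx x _ e0) _ xL).
by move=> z [_ _ /andP[_ zL]] zx; move: zL; rewrite (Lk _ zx) => /ltW.
Qed.

(** Composing with the retraction of the line onto [[0, 1]] removes the subspace topology from the
    later arguments. *)
Lemma jordan_clamp_continuous (R : realType) (n : nat) (gamma : R -> 'rV[R]_n) :
  {within `[0, 1], continuous gamma} ->
  continuous (fun t : R => gamma (Num.max 0 (Num.min t 1))).
Proof.
move=> /subspace_continuousP gc t; set cl := fun t : R => Num.max 0 (Num.min t 1).
have cl01 s : `[0, 1]%classic (cl s).
  by rewrite /= in_itv /= /cl le_max lexx ge_max ler01 ge_min lexx orbT.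
have clc : continuous cl.
  apply: (@max_fun_continuous _ _ R (fun=> 0) (fun t : R => Num.min t 1)).
    by move=> ?; exact: cvg_cst.
  by apply: (@min_fun_continuous _ _ R id (fun=> 1)) => ?; [exact: cvg_id|exact: cvg_cst].
move=> B /(gc _ (cl01 t)) /= HB.
by apply: (@filterS _ (nbhs t) _ _ _ _ (clc t _ HB)) => s h; exact: h (cl01 s).
Qed.

(** * Nondegeneracy and similarity of triangles, and the conclusion *)

Lemma ord3_neqP (v i : 'I_3) : i != v -> i = v + 1 \/ i = v + 2%:R.
Proof.
by move: v i => [[|[|[|//]]] ?] [[|[|[|//]]] ?] // _;
  [left|right|right|left|left|right]; apply: val_inj.
Qed.

Lemma triangle_side_neq0 (R : realType) (m : nat) (T : 'I_3 -> 'rV[R]_m) (v : 'I_3) :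
  triangle T -> T (v + 1) - T v != 0 /\ T (v + 2%:R) - T v != 0.
Proof.
move=> tri; split; apply/eqP => /eqP; rewrite subr_eq0 => /eqP e; apply: tri.
- exists (T v), (T (v + 2%:R) - T v) => i.
  have [->|/ord3_neqP[->|->]] := eqVneq i v; [exists 0|exists 0|exists 1];
    by rewrite ?scale0r ?addr0 // scale1r [T v + _]addrC subrK.
- exists (T v), (T (v + 1) - T v) => i.
  have [->|/ord3_neqP[->|->]] := eqVneq i v; [exists 0|exists 1|exists 0];
    by rewrite ?scale0r ?addr0 // scale1r [T v + _]addrC subrK.
Qed.

(** If [p] and [q] were on a line with the origin, equality would hold in Cauchy-Schwarz, forcing
    [kappa ^+ 2 = 1]. *)
Lemma triangle_points3 (R : realType) (n : nat) (p q : 'rV[R]_n) (kappa : R) :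
  kappa ^+ 2 < 1 -> p != 0 -> q != 0 ->
  dotv p q = kappa * (enorm p * enorm q) -> triangle (points3 0 p q).
Proof.
move=> k1 p0 q0 pq [a [u au]].
have [t0] := au 0; have [t1] := au 1; have [t2] := au 2%:R.
rewrite /points3 /= => e2 e1 e0.
have {e1} pE : p = (t1 - t0) *: u by rewrite scalerBl -[LHS]subr0 e1 e0 [a + t1 *: u]addrC addrKA.
have {e2} qE : q = (t2 - t0) *: u by rewrite scalerBl -[LHS]subr0 e2 e0 [a + t2 *: u]addrC addrKA.
have dotZ (x y : R) : dotv (x *: u) (y *: u) = x * y * dotv u u.
  by rewrite /dotv mulr_sumr; apply: eq_bigr => i _; rewrite !mxE; ring.
have : dotv p q ^+ 2 = dotv p p * dotv q q by rewrite pE qE !dotZ; ring.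
rewrite pq -!sqr_enorm -exprMn [in LHS]exprMn => /eqP.
rewrite -subr_eq0 -[X in _ - X]mul1r -mulrBl mulf_eq0 subr_eq0 (lt_eqF k1) /=.
by rewrite sqrf_eq0 mulf_eq0 !enorm_eq0 (negbTE p0) (negbTE q0).
Qed.

(** Side-angle-side: the law of cosines scales the third side by the same [r]. *)
Lemma similar_via_rot (R : realType) (n m : nat) (p q : 'rV[R]_n)
    (T : 'I_3 -> 'rV[R]_m) (v : 'I_3) (r : R) : 0 < r ->
  let u := T (v + 1) - T v in let w := T (v + 2%:R) - T v in
  enorm p = r * enorm u -> enorm q = r * enorm w ->
  dotv p q = cos (vertex_angle T v) * (enorm p * enorm q) ->
  exists2 sigma : {perm 'I_3}, sigma 0 = v & similar_via sigma (points3 0 p q) T.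
Proof.
move=> r0 u w pu qw pq.
(* The cyclic shift [i] to [v + i], matching the vertices [v + 1] and [v + 2] used by
   [vertex_angle]. *)
exists (perm (addrI v)); first by rewrite permE addr0.
exists r => //.
have dpq : dotv p q = r ^+ 2 * dotv u w.
  by rewrite pq pu qw (dotv_angle u) -/(vertex_angle T v); ring.
have dpp : dotv p p = r ^+ 2 * dotv u u by rewrite -!sqr_enorm pu exprMn.
have dqq : dotv q q = r ^+ 2 * dotv w w by rewrite -!sqr_enorm qw exprMn.
have op : Defs.edist 0 p = r * Defs.edist (T v) (T (v + 1)).
  by rewrite edistC [in RHS]edistC /Defs.edist subr0 pu.
have oq : Defs.edist 0 q = r * Defs.edist (T v) (T (v + 2%:R)).
  by rewrite edistC [in RHS]edistC /Defs.edist subr0 qw.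
have pqE : Defs.edist p q = r * Defs.edist (T (v + 1)) (T (v + 2%:R)).
  apply/eqP; rewrite -(eqrXn2 (n := 2)) ?mulr_ge0 ?enorm_ge0 ?(ltW r0) //.
  have uw : T (v + 1) - T (v + 2%:R) = u - w by apply/rowP => i; rewrite !mxE; ring.
  rewrite exprMn sqr_edist /Defs.edist uw sqr_enorm dotv_sub dpq dpp dqq.
  by apply/eqP; ring.
have o3 (i : 'I_3) : [\/ i = 0, i = 1 | i = 2%:R].
  by case: i => [[|[|[|//]]] ?]; [apply: Or31|apply: Or32|apply: Or33]; apply: val_inj.
move=> i j; rewrite !permE.
case: (o3 i) => ->; case: (o3 j) => ->; rewrite ?addr0 /points3 /= ?edistxx ?mulr0 //.
- by rewrite edistC op edistC.
- by rewrite edistC oq edistC.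
- by rewrite edistC pqE edistC.
Qed.

Theorem theorem1p3 (R : realType) (n : nat) (n_ge2 : (2 <= n)%N)
    (gamma : R -> 'rV[R]_n) (J : set 'rV[R]_n)
    (gammaJ : jordan_param gamma J) (gamma0 : gamma 0 = 0)
    (m : nat) (T : 'I_3 -> 'rV[R]_m) (triT : triangle T) (v : 'I_3)
    (hv : limsup_Theta gamma < vertex_angle T v < liminf_Theta' gamma) :
  exists p q : 'rV[R]_n,
    [/\ p \in J `\ (0 : 'rV[R]_n), q \in J `\ (0 : 'rV[R]_n),
        triangle (points3 0 p q)
      & exists2 sigma : {perm 'I_3},
          sigma 0 = v & similar_via sigma (points3 0 p q) T].
Proof.
case: gammaJ => gc g01 ginj ->.
case/andP: hv => /limsup_Theta_lt[d1 d1_gt0 near0] /lt_liminf_Theta'[d2 d2_gt0 near1].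
set theta := vertex_angle T v in near0 near1 *.
pose c (t : R) := gamma (Num.max 0 (Num.min t 1)).
have cE t : 0 <= t <= 1 -> c t = gamma t.
  by move=> /andP[t0 t1]; rewrite /c (min_idPl t1) (max_idPr t0).
have c0 : c 0 = 0 by rewrite cE ?gamma0 // lexx ler01.
have c1 : c 1 = 0 by rewrite cE -?g01 ?gamma0 // lexx ler01.
have cpair kappa mu d :=
  @proportional_pair R n c kappa mu d (jordan_clamp_continuous _ _ _ gc) c0 c1.
have gn0 t : 0 < t < 1 -> gamma t != 0.
  move=> t01; apply/eqP; rewrite -gamma0 => /ginj; clear -t01.
  by rewrite !in_itv /= => /(_ ltac:(lra) ltac:(lra)) [] [] *; lra.
rewrite gamma0 in near0 near1.
clear ginj g01 gamma0 c0 c1.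
have thI : theta \in `[0, pi] by exact: angle_itv.
(* The bound [1 / 2] keeps parameters near either end inside the open unit interval, where [c]
   agrees with [gamma] and does not vanish. *)
pose d := Num.min (1 / 2) (Num.min d1 d2).
have d0 : 0 < d by rewrite !lt_min d1_gt0 d2_gt0; lra.
have [dh dd1 dd2] : [/\ d <= 1 / 2, d <= d1 & d <= d2].
  by rewrite /d !ge_min !lexx !orbT.
(* Lying strictly between two actual angles, [theta] is neither 0 nor [pi]; this makes the triangle
   found below nondegenerate. *)
have th0 : 0 < theta.
  have d1h : 0 < d1 / 2 < d1 by lra.
  apply: le_lt_trans (near0 _ _ d1h d1h).
  by have := angle_itv (gamma (d1 / 2) - 0) (gamma (d1 / 2) - 0);
    rewrite in_itv /= => /andP[].
have thpi : theta < pi.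
  have d2h : 0 < d2 / 2 < d2 by lra.
  have d2h' : 1 - d2 < 1 - d2 / 2 < 1 by lra.
  apply: lt_le_trans (near1 _ _ d2h' d2h) _.
  by have := angle_itv (gamma (1 - d2 / 2) - 0) (gamma (d2 / 2) - 0);
    rewrite in_itv /= => /andP[].
have cos_lt1 : cos theta ^+ 2 < 1.
  by rewrite -(cos2Dsin2 theta) ltrDl exprn_gt0 // sin_gt0_pi // th0.
have pair (mu : R) : 0 < mu <= 1 -> exists s t, [/\ 0 < s < 1, 0 < t < 1,
    enorm (gamma s) = mu * enorm (gamma t)
    & dotv (gamma s) (gamma t) = cos theta * (enorm (gamma s) * enorm (gamma t))].
  move=> mu01.
  have [|||s [t [s01 t01 st dst]]] := cpair (cos theta) mu d _ mu01 d0.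
  - by move=> t t01; rewrite cE ?gn0 //; lra.
  - move=> s t sd td; rewrite !cE; try lra.
    rewrite -angle_lt ?gn0 //; try lra.
    by have := near0 s t; rewrite !subr0; apply; lra.
  - move=> s t sd td; rewrite !cE; try lra.
    rewrite -angle_gt ?gn0 //; try lra.
    (* [near1] takes the parameter close to 1 first, [proportional_pair] takes it second. *)
    by rewrite angleC; have := near1 t s; rewrite !subr0; apply; lra.
  by move: st dst; rewrite !cE; try lra; exists s, t.
have inJ t : 0 < t < 1 -> gamma t \in (gamma @` `[0, 1]) `\ (0 : 'rV[R]_n).
  move=> t01; rewrite inE; split; last exact/eqP/gn0.
  by exists t => //=; rewrite in_itv /=; lra.
have [] := triangle_side_neq0 _ _ _ v triT.
set u := T (v + 1) - T v; set w := T (v + 2%:R) - T v => u0 w0.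
have un : 0 < enorm u by rewrite enorm_gt0.
have wn : 0 < enorm w by rewrite enorm_gt0.
have finish p q : (exists2 t, 0 < t < 1 & p = gamma t) ->
    (exists2 t, 0 < t < 1 & q = gamma t) ->
    enorm p = enorm u / enorm w * enorm q ->
    dotv p q = cos theta * (enorm p * enorm q) ->
  exists p q : 'rV[R]_n,
    [/\ p \in (gamma @` `[0, 1]) `\ (0 : 'rV[R]_n),
        q \in (gamma @` `[0, 1]) `\ (0 : 'rV[R]_n),
        triangle (points3 0 p q)
      & exists2 sigma : {perm 'I_3},
          sigma 0 = v & similar_via sigma (points3 0 p q) T].
  move=> [s s01 ->] [t t01 ->] pq dpq; exists (gamma s), (gamma t); split; try exact: inJ.
  - by apply: (triangle_points3 _ _ _ _ _ cos_lt1); rewrite ?gn0.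
  - apply: (@similar_via_rot _ _ _ _ _ _ _ (enorm (gamma t) / enorm w)) => //.
    + by rewrite divr_gt0 // enorm_gt0 gn0.
    + by rewrite pq; field; rewrite gt_eqF.
    + by rewrite divfK // gt_eqF.
(* The ratio [mu] must not exceed 1, so the shorter side is divided by the longer; when [u] is the
   longer one, the two points found exchange roles. *)
have [uw|wu] := leP (enorm u) (enorm w).
  have [|s [t [s01 t01 st dst]]] := pair (enorm u / enorm w).
    by rewrite divr_gt0 //= ler_pdivrMr // mul1r.
  by apply: (finish (gamma s) (gamma t)) => //; [exists s|exists t].
have [|s [t [s01 t01 st dst]]] := pair (enorm w / enorm u).
  by rewrite divr_gt0 //= ler_pdivrMr // mul1r ltW.
apply: (finish (gamma t) (gamma s)); [by exists t|by exists s| |].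
- by rewrite st; field; rewrite !gt_eqF.
- by rewrite dotvC dst [enorm (gamma t) * _]mulrC.
Qed.
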